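(* Let $\mathcal{G}$ be a Fréchet $\widetilde{\mathbb{C}}$-module and $\mathcal{F}$ a Hausdorff barrelled topological $\widetilde{\mathbb{C}}$-module. If $T:\mathcal{G}\to\mathcal{F}$ is a $\widetilde{\mathbb{C}}$-linear, surjective and continuous map, then $T$ is open.
   Context: Generalized numbers: $\widetilde{\mathbb{C}}=\mathcal{E}_M/\mathcal{N}$, where $\mathcal{E}_M$ is the ring of nets $(c_\varepsilon)_\varepsilon\in\mathbb{C}^{(0,1]}$ with $|c_\varepsilon|=O(\varepsilon^{-N})$ as $\varepsilon\to0$ for some $N\in\mathbb{N}$, and $\mathcal{N}$ is the ideal of nets with $|c_\varepsilon|=O(\varepsilon^{q})$ for all $q\in\mathbb{N}$; $[(c_\varepsilon)_\varepsilon]$ denotes the class of $(c_\varepsilon)_\varepsilon$. The valuation is $\mathrm{v}(c)=\sup\{b\in\mathbb{R}: |c_\varepsilon|=O(\varepsilon^b)\text{ as }\varepsilon\to0\}$ and $|c|_{\mathrm e}=e^{-\mathrm{v}(c)}$; $\widetilde{\mathbb{C}}$ carries the topology of the ultrametric $|c-d|_{\mathrm e}$. A topological $\widetilde{\mathbb{C}}$-module is a $\widetilde{\mathbb{C}}$-module with a ($\widetilde{\mathbb{C}}$-linear) topology making addition and scalar multiplication $\widetilde{\mathbb{C}}\times\mathcal{G}\to\mathcal{G}$ continuous. A subset $A$ of a $\widetilde{\mathbb{C}}$-module $\mathcal{G}$ is balanced if $\lambda A\subseteq A$ whenever $|\lambda|_{\mathrm e}\le1$; absorbent if for every $u\in\mathcal{G}$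 there is $a\in\mathbb{R}$ with $u\in[(\varepsilon^b)_\varepsilon]A$ for all $b\le a$; convex if $A+A\subseteq A$ and $[(\varepsilon^b)_\varepsilon]A\subseteq A$ for all $b\ge0$. A topological $\widetilde{\mathbb{C}}$-module is locally convex if it has a base of convex neighborhoods of $0$. A Fréchet $\widetilde{\mathbb{C}}$-module is a complete metrizable locally convex topological $\widetilde{\mathbb{C}}$-module. A string in a $\widetilde{\mathbb{C}}$-module is a sequence $(U_n)_{n\ge1}$ of balanced and absorbent subsets (its knots) with $U_{n+1}+U_{n+1}\subseteq U_n$ for all $n$ and $[(\varepsilon^{-n})_\varepsilon]U_{n+p}\subseteq U_p$ for all $n,p\ge1$. In a topological $\widetilde{\mathbb{C}}$-module a string is closed if every knot is closed, and topological if every knot is a neighborhood of $0$. A topological $\widetilde{\mathbb{C}}$-module is barrelled if every closed string in it is topological. *)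

(* Defs.v *)
From HB Require Import structures.
From mathcomp Require Import all_boot all_order all_algebra ring_quotient.
From mathcomp Require Import generic_quotient.
From mathcomp Require Import boolp classical_sets functions filter topology.
From mathcomp Require Import pseudometric_normed_Zmodule.

Set Implicit Arguments.
Unset Strict Implicit.
Unset Printing Implicit Defensive.

(* These structures precede the import of the normed-space library on purpose:
   its topological modules are over a numDomainType, and HB refuses to declare
   modules over a general ring once they are in scope. *)

(* A ring with a topology; no compatibility between the two is assumed. *)
#[short(type="preTopologicalRingType")]
HB.structure Definition PreTopologicalRing :=
  {K of Topological K & GRing.PzRing K}.

HB.mixin Record isTopologicalModule (K : preTopologicalRingType) M
    & Topological M & GRing.Lmodule K M := {
  tmod_add_continuous : continuous (fun x : M * M => (x.1 + x.2)%R) ;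
  tmod_scale_continuous : continuous (fun z : K * M => (z.1 *: z.2)%R)
}.

#[short(type="topologicalModType")]
HB.structure Definition TopologicalModule (K : preTopologicalRingType) :=
  {M of Topological M & GRing.Lmodule K M & isTopologicalModule K M}.

From mathcomp Require Import all_classical all_reals all_analysis.
From mathcomp Require Import complex.

Import Order.TTheory GRing.Theory Num.Theory.
Import numFieldNormedType.Exports.

Local Open Scope classical_set_scope.
Local Open Scope complex_scope.
Local Open Scope ring_scope.
Local Open Scope quotient_scope.

Section Nets.
Variable R : realType.

Definition netidx : Type := {e : R | 0 < e <= 1}.

Lemma netidx1_subproof : 0 < (1 : R) <= 1.
Proof. by rewrite ltr01 lexx. Qed.

HB.instance Definition _ := SubChoice.copy netidx {e : R | 0 < e <= 1}.
HB.instance Definition _ := isPointed.Build netidx (Sub 1 netidx1_subproof).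

Lemma netidx_gt0 (e : netidx) : 0 < val e.
Proof. by case/andP: (valP e). Qed.

Lemma netidx_le1 (e : netidx) : val e <= 1.
Proof. by case/andP: (valP e). Qed.

(* the filter of neighbourhoods of 0 in (0, 1] *)
Definition net0 : set_system netidx :=
  filter_from [set d : R | 0 < d] (fun d => [set e : netidx | val e < d]).

Lemma net0_properfilter : ProperFilter net0.
Proof.
apply: filter_from_proper.
  apply: filter_from_filter; first by exists 1 => /=.
  move=> a b /= a0 b0; exists (Num.min a b); first by rewrite lt_min a0 b0.
  by move=> e /=; rewrite lt_min => /andP[].
move=> d /= d0.
have h : 0 < Num.min (d / 2) 1 <= (1 : R).
  by rewrite lt_min divr_gt0 //= ltr01 /= ge_min lexx orbT.
exists (Sub (Num.min (d / 2) 1) h) => /=.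
by rewrite gt_min ltr_pdivrMr // ltr_pMr // ltr1n.
Qed.
#[global] Existing Instance net0_properfilter.
Canonical net0_filter := FilterType net0 _.

(* |c_e| = O(e^b) as e -> 0, for a net c on (0, 1] *)
Definition Opow (c : netidx -> R[i]) (b : R) : Prop :=
  (fun e => Normc.normc (c e) : R^o) =O_net0 (fun e => (val e `^ b) : R^o).

Lemma OpowP c b : Opow c b <->
  exists2 k : R, 0 < k & \forall e \near net0, Normc.normc (c e) <= k * val e `^ b.
Proof.
rewrite /Opow; split.
  move=> /eqO_exP [k k0 H]; exists k => //; apply: filterS H => e /=.
  rewrite [X in _ <= _ * X]ger0_norm ?powR_ge0 // => H.
  by apply: le_trans H; rewrite ler_norm.
move=> [k k0 H]; apply/eqO_exP; exists k => //; apply: filterS H => e /= H.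
rewrite [X in _ <= _ * X]ger0_norm ?powR_ge0 // ger0_norm //.
by case: (c e) => x y /=; rewrite sqrtr_ge0.
Qed.

Lemma normc_ge0 (z : R[i]) : 0 <= Normc.normc z.
Proof. by case: z => x y /=; rewrite sqrtr_ge0. Qed.

Lemma OpowW c b b' : b' <= b -> Opow c b -> Opow c b'.
Proof.
move=> bb /OpowP[k k0 H]; apply/OpowP; exists k => //; apply: filterS H => e H.
apply: (le_trans H); apply: ler_wpM2l; first exact: ltW.
by apply: ger_powR => //; exact: (valP e).
Qed.

Lemma OpowD c d b : Opow c b -> Opow d b -> Opow (c + d) b.
Proof.
move=> /OpowP[k k0 H] /OpowP[l l0 K]; apply/OpowP; exists (k + l).
  exact: addr_gt0.
apply: filterS2 H K => e H K; apply: le_trans (le_normcD _ _) _.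
by rewrite mulrDl lerD.
Qed.

Lemma OpowN c b : Opow c b -> Opow (- c) b.
Proof.
move=> /OpowP[k k0 H]; apply/OpowP; exists k => //.
by apply: filterS H => e; rewrite -normcN.
Qed.

Lemma OpowM c d b b' : Opow c b -> Opow d b' -> Opow (c * d) (b + b').
Proof.
move=> /OpowP[k k0 H] /OpowP[l l0 K]; apply/OpowP; exists (k * l).
  exact: mulr_gt0.
apply: filterS2 H K => e H K; rewrite Normc.normcM.
rewrite powRD ?(gt_eqF (netidx_gt0 e)) ?implybT // mulrACA.
by apply: ler_pM => //; exact: normc_ge0.
Qed.

Lemma Opow0 b : Opow 0 b.
Proof.
apply/OpowP; exists 1 => //; near=> e.
by rewrite Normc.normc0 mul1r powR_ge0.
Unshelve. all: by end_near. Qed.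

Lemma Opow1 : Opow 1 0.
Proof.
apply/OpowP; exists 1 => //; near=> e.
by rewrite Normc.normc1 mul1r powRr0.
Unshelve. all: by end_near. Qed.

(* The carrier of the ring E_M, [nullnet] below being the ideal N. *)
Definition moderate : {pred netidx -> R[i]} :=
  fun c => `[< exists N : nat, Opow c (- N%:R) >].

Lemma moderate_subring : subring_closed moderate.
Proof.
have W c (N M : nat) : (N <= M)%N -> Opow c (- N%:R) -> Opow c (- M%:R).
  by move=> NM; apply: OpowW; rewrite lerN2 ler_nat.
split.
- by apply/asboolP; exists 0%N; rewrite oppr0; exact: Opow1.
- move=> c d /asboolP[N cN] /asboolP[M dM]; apply/asboolP; exists (maxn N M).
  apply: OpowD; first exact: W (leq_maxl _ _) cN.
  by apply: OpowN; exact: W (leq_maxr _ _) dM.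
- move=> c d /asboolP[N cN] /asboolP[M dM]; apply/asboolP; exists (N + M)%N.
  by rewrite natrD opprD; exact: OpowM.
Qed.

Definition modnet : Type := {c | moderate c}.
HB.instance Definition _ := SubChoice.copy modnet {c | moderate c}.
HB.instance Definition _ :=
  GRing.SubChoice_isSubComNzRing.Build (netidx -> R[i]) moderate modnet
    moderate_subring.

Definition nullnet : {pred modnet} :=
  fun c => `[< forall q : nat, Opow (val c) q%:R >].

Lemma not_Opow1_1 : ~ Opow 1 1.
Proof.
move=> /OpowP[k k0 [d /= d0 H]].
pose x := Num.min (Num.min (d / 2) (k^-1 / 2)) 1.
have h : 0 < x <= 1.
  by rewrite !lt_min !divr_gt0 ?invr_gt0 //= ltr01 /= ge_min lexx orbT.
have {}H (e : netidx) : val e < d -> 1 <= k * val e.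
  move=> /H; rewrite /= powRr1 ?(ltW (netidx_gt0 e)) //.
  by move: (@Normc.normc1 R) => /= ->.
have := H (Sub x h); rewrite /=.
have xd : x < d.
  by rewrite /x !gt_min ltr_pdivrMr // ltr_pMr // ltr1n.
move=> /(_ xd); apply/negP; rewrite -ltNge.
have : k * x <= k * (k^-1 / 2).
  by apply: ler_wpM2l; rewrite ?(ltW k0) // /x !ge_min lexx orbT.
move/le_lt_trans; apply; rewrite mulrA divff ?gt_eqF // mul1r.
by rewrite invf_lt1 // ltr1n.
Qed.

Lemma nullnet_ideal : idealr_closed nullnet.
Proof.
split.
- by apply/asboolP => q; rewrite raddf0; exact: Opow0.
- by apply/negP => /asboolP /(_ 1%N); rewrite rmorph1; exact: not_Opow1_1.
- move=> a c d /asboolP cN /asboolP dN; apply/asboolP => q.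
  rewrite (rmorphD val) (rmorphM val); apply: OpowD => //.
  have /asboolP [N aN] := valP a.
  by have := OpowM aN (cN (N + q)%N); rewrite natrD addKr.
Qed.

HB.instance Definition _ := isIdealr.Build modnet nullnet nullnet_ideal.

Definition gcomplex : Type := {ideal_quot nullnet}.
HB.instance Definition _ := GRing.ComNzRing.on gcomplex.
HB.instance Definition _ := Choice.on gcomplex.
HB.instance Definition _ := EqQuotient.on gcomplex.

Definition gclass (c : modnet) : gcomplex := \pi_gcomplex c.

Local Open Scope ereal_scope.

(* Stated on a chosen representative; see valuation_gclass for independence. *)
Definition valuation (c : gcomplex) : \bar R :=
  ereal_sup [set b%:E | b in Opow (val (repr c))].

Lemma valuation_gclass (c : modnet) :
  valuation (gclass c) = ereal_sup [set b%:E | b in Opow (val c)].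
Proof.
suff E : Opow (val (repr (gclass c))) = Opow (val c) by rewrite /valuation E.
have : repr (gclass c) = c %[mod {ideal_quot nullnet}] by rewrite reprK.
move=> /eqP; rewrite -Quotient.idealrBE => /asboolP H.
have K b : Opow (val (repr (gclass c) - c)%R) b.
  apply: OpowW (H (Num.bound `|b|%R)).
  by apply: ltW; apply: le_lt_trans (ler_norm _) (archi_boundP _).
apply/seteqP; split => b /= Hb.
  have -> : (val c = val (repr (gclass c)) - val (repr (gclass c) - c))%R.
    by rewrite rmorphB opprB addrC subrK.
  by apply: OpowD => //; exact: OpowN.
have -> : (val (repr (gclass c)) = val (repr (gclass c) - c) + val c)%R.
  by rewrite rmorphB subrK.
exact: OpowD.
Qed.

Lemma gclassE (c : gcomplex) : gclass (repr c) = c.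
Proof. exact: reprK. Qed.

Lemma valuation_ge (c : modnet) b : Opow (val c) b -> b%:E <= valuation (gclass c).
Proof. by move=> cb; rewrite valuation_gclass; apply: ereal_sup_ubound; exists b. Qed.

Lemma valuation_gtP (c : gcomplex) x : x < valuation c ->
  exists2 b, Opow (val (repr c)) b & x < b%:E.
Proof. by move=> /ereal_sup_gt[_ [b cb <-] xb]; exists b. Qed.

Lemma valuation_gtNy (c : gcomplex) : -oo < valuation c.
Proof.
have /asboolP [N cN] := valP (repr c).
by apply: lt_le_trans (ltNyr (- N%:R)%R) _; rewrite -(gclassE c) valuation_ge.
Qed.

Lemma valuation0 : valuation (0%R : gcomplex) = +oo.
Proof.
have -> : (0%R : gcomplex) = gclass 0%R by rewrite /gclass raddf0.
by apply: eq_infty => b; apply: valuation_ge; rewrite raddf0; exact: Opow0.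
Qed.

Lemma valuation_eqy (c : gcomplex) : valuation c = +oo -> c = 0%R.
Proof.
move=> vc; rewrite -(gclassE c) -[RHS](gclassE 0%R) /gclass.
have -> : repr (0%R : gcomplex) = 0%R %[mod {ideal_quot nullnet}].
  by rewrite reprK raddf0.
apply/eqP; rewrite -Quotient.idealrBE subr0; apply/asboolP => q.
have /valuation_gtP[b cb qb] : q%:R%:E < valuation c by rewrite vc ltry.
by apply: OpowW cb; rewrite ltW // -lte_fin.
Qed.

Lemma valuationN (c : gcomplex) : valuation (- c)%R = valuation c.
Proof.
suff H x : valuation x <= valuation (- x)%R.
  by apply/eqP; rewrite eq_le H andbT -{2}(opprK c) H.
rewrite /valuation; apply: ge_ereal_sup => _ [b xb <-].
rewrite -/(valuation _) -(gclassE x) /gclass -raddfN; apply: valuation_ge.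
by rewrite raddfN; exact: OpowN.
Qed.

Lemma valuationD (x y : gcomplex) :
  mine (valuation x) (valuation y) <= valuation (x + y)%R.
Proof.
rewrite leNgt; apply/negP; rewrite lt_min.
move=> /andP[/valuation_gtP[b xb vb] /valuation_gtP[d yd vd]].
have : (Num.min b d)%:E <= valuation (x + y)%R.
  rewrite -{1}(gclassE x) -{1}(gclassE y) /gclass -raddfD.
  apply: valuation_ge; rewrite raddfD; apply: OpowD.
    by apply: OpowW xb; rewrite ge_min lexx.
  by apply: OpowW yd; rewrite ge_min lexx orbT.
by apply/negP; rewrite -ltNge EFin_min lt_min vb vd.
Qed.

(* |c|_e = e^(- v(c)), equal to 0 when v(c) = +oo; see gabs_fin. *)
Definition gabs (c : gcomplex) : R := fine (expeR (- valuation c)).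

Lemma gabs_fin (c : gcomplex) : expeR (- valuation c) = (gabs c)%:E.
Proof.
rewrite fineK // ge0_fin_numE ?expeR_ge0 // lt_neqAle leey andbT expeR_eqy.
by rewrite eqe_oppLR gt_eqF // valuation_gtNy.
Qed.

Lemma gabs0 : gabs 0%R = 0%R.
Proof. by rewrite /gabs valuation0. Qed.

Lemma gabs_ge0 c : (0 <= gabs c)%R.
Proof. by rewrite -lee_fin -gabs_fin expeR_ge0. Qed.

Lemma gabs_eq0 c : gabs c = 0%R -> c = 0%R.
Proof.
move=> c0; apply: valuation_eqy; have := gabs_fin c; rewrite c0 => /eqP.
by rewrite expeR_eq0 eqe_oppLR => /eqP.
Qed.

Lemma gabsN c : gabs (- c)%R = gabs c.
Proof. by rewrite /gabs valuationN. Qed.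

Lemma gabsD x y : (gabs (x + y) <= Num.max (gabs x) (gabs y))%R.
Proof.
have : expeR (- valuation (x + y)%R) <= expeR (- mine (valuation x) (valuation y)).
  by rewrite lee_expeR leeN2 valuationD.
rewrite gabs_fin; case: (leP (valuation x) (valuation y)) => _;
  by rewrite gabs_fin lee_fin => /le_trans; apply; rewrite le_max lexx ?orbT.
Qed.

Definition gdist (c d : gcomplex) : R := gabs (c - d)%R.

Lemma gdistxx c : gdist c c = 0%R.
Proof. by rewrite /gdist subrr gabs0. Qed.

Lemma gdist_positivity c d : gdist c d = 0%R -> c = d.
Proof. by move=> /gabs_eq0/subr0_eq. Qed.

Lemma gdist_sym c d : gdist c d = gdist d c.
Proof. by rewrite /gdist -gabsN opprB. Qed.

Lemma gdist_triangle d c e : (gdist c e <= gdist c d + gdist d e)%R.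
Proof.
rewrite /gdist (_ : c - e = (c - d) + (d - e))%R; last by rewrite addrA subrK.
apply: (le_trans (gabsD _ _)).
by rewrite ge_max lerDl lerDr !gabs_ge0.
Qed.

(* The topology of gcomplex is the one of the ultrametric gdist. *)
HB.instance Definition _ := @isMetric.Build R gcomplex gdist
  gdistxx gdist_positivity gdist_sym gdist_triangle.

Local Close Scope ereal_scope.

Lemma normc_real (x : R) : 0 <= x -> Normc.normc x%:C = x.
Proof. by move=> x0; rewrite /= expr0n /= addr0 sqrtr_sqr ger0_norm. Qed.

Lemma moderate_epow (b : R) : moderate (fun e : netidx => (val e `^ b)%:C).
Proof.
apply/asboolP; exists (Num.bound `|b|).
apply: (@OpowW _ b).
  rewrite lerNl; apply: ltW; apply: le_lt_trans (archi_boundP (normr_ge0 _)).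
  by rewrite -normrN ler_norm.
apply/OpowP; exists 1 => //; near=> e.
by rewrite normc_real ?powR_ge0 // mul1r.
Unshelve. all: by end_near. Qed.

(* [(e^b)_e] *)
Definition epow (b : R) : gcomplex := gclass (Sub _ (moderate_epow b)).

End Nets.

Section Modules.
Variables (R : realType) (M : lmodType (gcomplex R)).
Implicit Types (A B : set M) (U : nat -> set M).

Definition scale_set (c : gcomplex R) A : set M := [set c *: u | u in A].
Definition sum_set A B : set M := [set u + v | u in A & v in B].

Definition balanced A := forall c : gcomplex R, gabs c <= 1 -> scale_set c A `<=` A.

Definition absorbent A := forall u, exists a : R, forall b : R, b <= a ->
  scale_set (epow b) A u.

Definition gconvex A := sum_set A A `<=` A /\
  forall b : R, 0 <= b -> scale_set (epow b) A `<=` A.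

(* The knots are U 1, U 2, ...; the value U 0 is irrelevant. *)
Definition is_string U :=
  [/\ forall n, (0 < n)%N -> balanced (U n) /\ absorbent (U n),
      forall n, (0 < n)%N -> sum_set (U n.+1) (U n.+1) `<=` U n &
      forall n p, (0 < n)%N -> (0 < p)%N ->
        scale_set (epow (- n%:R)) (U (n + p)%N) `<=` U p].

End Modules.

Section TopologicalModules.
Variables (R : realType) (M : topologicalModType (gcomplex R)).

Definition closed_string (U : nat -> set M) :=
  is_string U /\ forall n, (0 < n)%N -> closed (U n).

Definition topological_string (U : nat -> set M) :=
  is_string U /\ forall n, (0 < n)%N -> nbhs 0 (U n).

Definition barrelled := forall U : nat -> set M,
  closed_string U -> topological_string U.

Definition locally_gconvex := exists B : set_system M,
  (forall V, B V -> nbhs 0 V /\ gconvex V) /\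
  (forall U, nbhs 0 U -> exists2 V, B V & V `<=` U).

Definition metrizable := exists d : M -> M -> R,
  [/\ forall x y, d x y = 0 <-> x = y,
      forall x y, d x y = d y x,
      forall x y z, d x z <= d x y + d y z &
      forall x, nbhs x = filter_from [set r | 0 < r] (fun r => [set y | d x y < r])].

(* Completeness for the canonical uniformity of the additive group M. *)
Definition gcauchy (F : set_system M) := forall U, nbhs 0 U ->
  exists2 A, F A & forall x y, A x -> A y -> U (x - y).

Definition gcomplete := forall F : set_system M, ProperFilter F ->
  gcauchy F -> exists x : M, F --> x.

Definition frechet := [/\ gcomplete, metrizable & locally_gconvex].

End TopologicalModules.

Definition open_map (X Y : topologicalType) (f : X -> Y) :=
  forall A : set X, open A -> open (f @` A).

(* Main.v *)
Require Import Defs.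
From mathcomp Require Import all_boot all_order all_algebra.
From mathcomp Require Import unstable all_classical all_reals all_analysis.
From mathcomp Require Import complex.

(** The proof is the string version of the classical open mapping theorem, with
    barrelledness of the target taking the place of the Baire category argument.

    Given a neighbourhood W of 0 in G, metrizability yields a string U of
    neighbourhoods of 0 in G whose knots eventually enter every neighbourhood
    of 0 and with U 1 + U 1 contained in W ([topological_string_exists]).  As T
    is linear and onto, the closures of the images T (U n) form a closed string
    in F ([closed_string_closure_image]), so they are neighbourhoods of 0: T is
    almost open.

    Completeness of G removes the closure
    ([closure_image_sub_image_closure]): a point y in the closure of T (U 2) is
    approximated by some T x with x in U 2 up to an error in the closure of
    T (U 3), this error is approximated in the same way, and so on.  The
    corrections form a convergent series with sum l in the closure of U 1,
    because the knots of a string halve at each step, and T l = y because the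
    errors tend to 0 in the Hausdorff module F.  Since the closure of U 1 is
    contained in U 1 + U 1, hence in W, T W is a neighbourhood of 0, and
    translations give openness everywhere.

    The existence of strings of neighbourhoods rests on two facts about the
    scalars: the ultrametric absolute value is submultiplicative, and the
    invertible scalars [epow b] tend to 0 as b grows. *)

Set Implicit Arguments.
Unset Strict Implicit.
Unset Printing Implicit Defensive.

Import Order.TTheory GRing.Theory Num.Theory.

Local Open Scope classical_set_scope.
Local Open Scope ring_scope.

(** * The absolute value on generalized numbers *)

Section GeneralizedNumbers.
Context {R : realType}.
Implicit Types x y c : gcomplex R.

Lemma gabs_gclass_le (c : modnet R) (b : R) :
  Opow (val c) b -> gabs (gclass c) <= expR (- b).
Proof.
move=> cb; rewrite -lee_fin -gabs_fin -[(expR _)%:E]/(expeR (- b)%:E).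
by rewrite lee_expeR EFinN leeN2 valuation_ge.
Qed.

(** The supremum defining the valuation need not be attained, so only strict
    upper bounds of the absolute value yield an exponent for a representative. *)
Lemma gabs_ltP c (r : R) : gabs c < r ->
  exists2 b, Opow (val (repr c)) b & expR (- b) < r.
Proof.
move=> cr; have r0 : 0 < r by apply: le_lt_trans cr; exact: gabs_ge0.
have : ((- ln r)%:E < valuation c)%E.
  rewrite EFinN lteNl -lte_expeR gabs_fin /= lnK ?lte_fin //.
move=> /valuation_gtP[b cb rb]; exists b => //.
by rewrite -[r]lnK // ltr_expR ltrNl -lte_fin.
Qed.

(** Exponents of representatives add up under multiplication; passing to the
    infimum of the strict upper bounds of each factor in turn gives the bound. *)
Lemma gabsM_le x y : gabs (x * y) <= gabs x * gabs y.
Proof.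
have step r s : gabs x < r -> gabs y < s -> gabs (x * y) <= r * s.
  move=> /gabs_ltP[b xb br] /gabs_ltP[d yd ds].
  rewrite -(gclassE x) -(gclassE y) /gclass -rmorphM.
  apply: le_trans (@gabs_gclass_le _ (b + d) _) _.
    exact: OpowM.
  by rewrite opprD expRD ler_pM ?expR_ge0 ?ltW.
have half s : gabs y < s -> gabs (x * y) <= gabs x * s.
  move=> ys; have s0 : 0 < s by apply: le_lt_trans ys; exact: gabs_ge0.
  rewrite -ler_pdivrMr //; apply/ler_gtP => r xr.
  by rewrite ler_pdivrMr // step.
have [x0|x0] := eqVneq (gabs x) 0.
  by rewrite (gabs_eq0 x0) mul0r gabs0 mul0r.
have {}x0 : 0 < gabs x by rewrite lt_neqAle eq_sym x0 gabs_ge0.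
rewrite -ler_pdivrMl //; apply/ler_gtP => s ys.
by rewrite ler_pdivrMl // half.
Qed.

Lemma epow0 : epow 0 = 1 :> gcomplex R.
Proof.
have -> : 1 = gclass 1 :> gcomplex R by rewrite /gclass rmorph1.
by congr gclass; apply: val_inj; apply/funext => e /=; rewrite powRr0.
Qed.

Lemma epowD (a b : R) : epow (a + b) = epow a * epow b.
Proof.
rewrite /epow; have -> u v : gclass u * gclass v = gclass (u * v) :> gcomplex R.
  by rewrite /gclass rmorphM.
congr gclass; apply: val_inj; apply/funext => e /=.
rewrite powRD ?(gt_eqF (netidx_gt0 e)) ?implybT //. exact: (rmorphM (real_complex R)).
Qed.

Lemma gabs_epow_le (b : R) : gabs (epow b) <= expR (- b).
Proof.
apply: gabs_gclass_le; apply/OpowP; exists 1 => //; near=> e.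
by rewrite normc_real ?powR_ge0 // mul1r.
Unshelve. all: by end_near. Qed.

Lemma gabs1_le : gabs (1 : gcomplex R) <= 1.
Proof. by rewrite -epow0 (le_trans (gabs_epow_le _)) // oppr0 expR0. Qed.

Lemma ball0P c (r : R) : ball (0 : gcomplex R) r c <-> gabs c < r.
Proof. by rewrite -(gabsN c) -sub0r. Qed.

Lemma epow_cvg0 : epow b @[b --> +oo] --> (0 : gcomplex R).
Proof.
apply/cvg_ballP => r r0; near=> b; apply/ball0P.
rewrite (le_lt_trans (gabs_epow_le b)) //; near: b.
exact: (cvgr_lt _ (@cvgr_expR R)).
Unshelve. all: by end_near. Qed.

End GeneralizedNumbers.

(** * Neighbourhoods of zero and closures in topological modules *)

Section TopologicalModules.
Context {R : realType} {M : topologicalModType (gcomplex R)}.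
Implicit Types (A B V W : set M) (u x : M) (c : gcomplex R).

Lemma tmod_cvgD {I : Type} {Phi : set_system I} {FF : Filter Phi} (f g : I -> M) x y :
  f @ Phi --> x -> g @ Phi --> y -> (fun i => f i + g i) @ Phi --> x + y.
Proof. exact: continuous2_cvg (tmod_add_continuous (x, y)). Qed.

Lemma tmod_cvgZ {I : Type} {Phi : set_system I} {FF : Filter Phi}
    (k : I -> gcomplex R) (f : I -> M) c x :
  k @ Phi --> c -> f @ Phi --> x -> (fun i => k i *: f i) @ Phi --> c *: x.
Proof. exact: continuous2_cvg (tmod_scale_continuous (c, x)). Qed.

Lemma tmod_cvgB {I : Type} {Phi : set_system I} {FF : Filter Phi} (f g : I -> M) x y :
  f @ Phi --> x -> g @ Phi --> y -> (fun i => f i - g i) @ Phi --> x - y.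
Proof.
move=> fx gy; apply: tmod_cvgD => //; rewrite -scaleN1r.
under eq_fun do rewrite -scaleN1r.
by apply: tmod_cvgZ => //; exact: cvg_cst.
Qed.

Lemma scaler_continuous c : continuous (fun u : M => c *: u).
Proof. by move=> u; apply: tmod_cvgZ => //; exact: cvg_cst. Qed.

Lemma nbhs_subl x A : nbhs 0 A -> nbhs x [set y | A (x - y)].
Proof.
move=> A0; have : (fun y => x - y) @ x --> x - x.
  by apply: tmod_cvgB => //; exact: cvg_cst.
by rewrite subrr; exact.
Qed.

Lemma nbhs_subr x A : nbhs 0 A -> nbhs x [set y | A (y - x)].
Proof.
move=> A0; have : (fun y => y - x) @ x --> x - x.
  by apply: tmod_cvgB => //; exact: cvg_cst.
by rewrite subrr; exact.
Qed.

Lemma nbhs_addl x A : nbhs x A -> nbhs 0 [set u | A (x + u)].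
Proof.
move=> Ax; have : (fun u => x + u) @ 0 --> x + 0.
  by apply: tmod_cvgD => //; exact: cvg_cst.
by rewrite addr0; exact.
Qed.

Lemma nbhs0_scale c W : nbhs 0 W -> nbhs 0 [set u | W (c *: u)].
Proof.
by move=> W0; have := @scaler_continuous c 0; rewrite /continuous_at scaler0; exact.
Qed.

Lemma nbhs0_sum W : nbhs 0 W -> exists2 V, nbhs 0 V & sum_set V V `<=` W.
Proof.
rewrite -[X in nbhs X W]addr0 => /(tmod_add_continuous (0, 0)) [[P Q] /= [P0 Q0] PQ].
exists (P `&` Q); first exact: filterI.
by move=> _ [u [Pu _] [v [_ Qv] <-]]; exact: (PQ (u, v)).
Qed.

(** The balanced core of W is a neighbourhood of 0: continuity of scalar
    multiplication at (0, 0) gives r > 0 and Q with c *: u in W for |c| < r and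
    u in Q, so the core contains [epow b] Q as soon as |epow b| < r, and this is
    a neighbourhood because [epow b] is invertible. *)
Lemma nbhs0_balanced W : nbhs 0 W ->
  exists V, [/\ nbhs 0 V, balanced V & V `<=` W].
Proof.
rewrite -[X in nbhs X W](scaler0 _ 0) => /(tmod_scale_continuous (0, 0)).
move=> [[P Q] /= [/nbhs_ballP[r /= r0 Pr] Q0] PQ].
exists [set u | forall c, gabs c <= 1 -> W (c *: u)]; split.
- have [b rb] : exists b : R, gabs (epow b) < r.
    have /cvg_ballP/(_ r r0) := @epow_cvg0 R.
    by move=> /filter_ex[b /ball0P]; exists b.
  apply: filterS (nbhs0_scale (epow (- b)) Q0) => u /= Qu c c1.
  rewrite -[u]scale1r -epow0 -(subrr b) epowD -scalerA scalerA.
  apply: (PQ (_, _)); split => //=; apply/Pr/ball0P.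
  rewrite (le_lt_trans (gabsM_le _ _)) //.
  by rewrite (le_lt_trans _ rb) // ler_piMl // gabs_ge0.
- move=> c c1 _ [u Vu <-] d d1; rewrite scalerA; apply: Vu.
  by rewrite (le_trans (gabsM_le _ _)) // mulr_ile1 // gabs_ge0.
- by move=> u /(_ 1 gabs1_le); rewrite scale1r.
Qed.

Lemma balancedN A u : balanced A -> A u -> A (- u).
Proof.
move=> Abal Au; apply: (Abal (- 1)); first by rewrite gabsN gabs1_le.
by exists u; rewrite // scaleN1r.
Qed.

(** For fixed u, [epow b *: u] tends to 0 as b tends to infinity. *)
Lemma nbhs0_absorbent W : nbhs 0 W -> absorbent W.
Proof.
move=> W0 u; have : epow b *: u @[b --> +oo] --> (0 : M).
  by rewrite -[0](scale0r u); apply: tmod_cvgZ; [exact: epow_cvg0|exact: cvg_cst].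
move=> /(_ W W0)[a [_ aW]]; exists (- (a + 1)) => b ba.
exists (epow (- b) *: u); last by rewrite scalerA -epowD subrr epow0 scale1r.
by apply: aW; rewrite ltrNr (le_lt_trans ba) // ltrN2 ltrDl.
Qed.

Lemma closure_scale c A : scale_set c (closure A) `<=` closure (scale_set c A).
Proof.
move=> _ [u Au <-] B /scaler_continuous /Au[v [Av Bv]].
by exists (c *: v); split => //; exists v.
Qed.

Lemma closure_sum A B :
  sum_set (closure A) (closure B) `<=` closure (sum_set A B).
Proof.
move=> _ [u Au [v Bv <-]] C /(tmod_add_continuous (u, v))[[P Q] /= [Pu Qv] PQ].
have [u' [Au' Pu']] := Au _ Pu; have [v' [Bv' Qv']] := Bv _ Qv.
exists (u' + v'); split; last exact: (PQ (u', v')).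
by exists u' => //; exists v'.
Qed.

Lemma closure_sub_sum A V : nbhs 0 V -> closure A `<=` sum_set A V.
Proof.
move=> V0 u /(_ _ (nbhs_subl u V0))[a [Aa Va]].
by exists a => //; exists (u - a); rewrite // subrKC.
Qed.

(** One step in the construction of a string.  Scaling by [epow (- 1)] is enough:
    the condition of a string on [epow (- n)] follows by taking n steps. *)
Lemma nbhs0_refine W : nbhs 0 W -> exists V, [/\ nbhs 0 V, balanced V,
  sum_set V V `<=` W & scale_set (epow (- 1)) V `<=` W].
Proof.
move=> W0; have [V1 V10 V1W] := nbhs0_sum W0.
have [V [V0 Vbal VW]] :=
  nbhs0_balanced (filterI V10 (nbhs0_scale (epow (- 1)) W0)).
exists V; split => //.
  by move=> _ [u /VW[Vu _] [v /VW[Vv _] <-]]; apply: V1W; exists u => //; exists v.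
by move=> _ [u /VW[_ Wu] <-].
Qed.

(** Every neighbourhood W of 0 starts a string of neighbourhoods which can
    moreover be made to shrink as fast as a prescribed sequence B. *)
Lemma topological_string_exists (B : nat -> set M) W :
  (forall n, nbhs 0 (B n)) -> nbhs 0 W ->
  exists U : nat -> set M, [/\ topological_string U, sum_set (U 1%N) (U 1%N) `<=` W
    & forall n, U n.+1 `<=` B n].
Proof.
move=> B0 W0.
have /choice[f fP] : forall V : set M, exists V', nbhs 0 V ->
    [/\ nbhs 0 V', balanced V', sum_set V' V' `<=` V
      & scale_set (epow (- 1)) V' `<=` V].
  (* The premise sits below the existential so that f is a total function. *)
  move=> V; have [/nbhs0_refine[V' V'P]|nV] := pselect (nbhs 0 V).
    by exists V'.
  by exists setT.
pose U := fix U n := if n is n'.+1 then f (U n' `&` B n') else W.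
have U0 n : nbhs 0 (U n).
  by elim: n => //= n IHn; have [] := fP _ (filterI IHn (B0 n)).
have [Ubal Usum Uscale] : [/\ forall n, balanced (U n.+1),
    forall n, sum_set (U n.+1) (U n.+1) `<=` U n `&` B n &
    forall n, scale_set (epow (- 1)) (U n.+1) `<=` U n `&` B n].
  by split=> n; have [] := fP _ (filterI (U0 n) (B0 n)).
exists U; split.
- split=> [|[]//]; split.
  + by move=> [//|n] _; split; [exact: Ubal|exact: nbhs0_absorbent].
  + by move=> n _ u /Usum[].
  + move=> n p _ _; elim: n => [|n IHn].
      by rewrite oppr0 epow0 => _ [u Uu <-]; rewrite scale1r.
    move=> _ [u Uu <-]; apply: IHn; exists (epow (- 1) *: u).
      suff [] : (U (n + p)%N `&` B (n + p)%N) (epow (- 1) *: u) by [].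
      by apply: Uscale; exists u.
    by rewrite scalerA -epowD -opprD natr1.
- by move=> u /Usum[].
- (* U n.+1 is contained in U n.+1 + U n.+1 since 0 is in it. *)
  move=> n u Uu; suff [] : (U n `&` B n) u by [].
  apply: Usum; exists u => //; exists 0.
    exact: nbhs_singleton (U0 n.+1).
  by rewrite addr0.
Qed.

End TopologicalModules.

(** Surjectivity of T makes the images absorbent; the other conditions pass to
    images by linearity and to closures by continuity of the operations. *)
Lemma closed_string_closure_image (R : realType) (G : lmodType (gcomplex R))
    (F : topologicalModType (gcomplex R)) (T : {linear G -> F}) (U : nat -> set G) :
  set_surj setT setT T -> is_string U ->
  closed_string (fun n => closure (T @` U n)).
Proof.
move=> Tsurj [Uba Usum Uscale]; split=> [|n _]; last exact: closed_closure.
split=> [n n0|n n0|n p n0 p0].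
- have [Ubal Uabs] := Uba n n0; split=> [c c1|y].
    apply: (subset_trans (@closure_scale _ _ _ _)); apply: closureS.
    move=> _ [_ [u Uu <-] <-]; exists (c *: u); last by rewrite linearZ.
    by apply: (Ubal c c1); exists u.
  have [u _ <-] := Tsurj y I; have [a aU] := Uabs u.
  exists a => b /aU[v Uv <-]; exists (T v); last by rewrite linearZ.
  by apply: subset_closure; exists v.
- apply: (subset_trans (@closure_sum _ _ _ _)); apply: closureS.
  move=> _ [_ [u Uu <-] [_ [v Uv <-] <-]]; exists (u + v); last by rewrite linearD.
  by apply: Usum => //; exists u => //; exists v.
- apply: (subset_trans (@closure_scale _ _ _ _)); apply: closureS.
  move=> _ [_ [u Uu <-] <-]; exists (epow (- n%:R) *: u); last by rewrite linearZ.
  by apply: (Uscale n p) => //; exists u.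
Qed.

(** * From almost open to open *)

Section CompletenessAndStrings.
Context {R : realType}.
Context {G F : topologicalModType (gcomplex R)} {U : nat -> set G}.
Context (Utop : topological_string U).

Let U0 n : nbhs 0 (U n.+1).
Proof. by case: Utop => _; apply. Qed.

Let Usum n : sum_set (U n.+2) (U n.+2) `<=` U n.+1.
Proof. by case: Utop => -[_ + _] _; apply. Qed.

Lemma string_decreasing m n : (m <= n)%N -> U n.+1 `<=` U m.+1.
Proof.
move=> /subnK <-; elim: (n - m)%N => // k IHk u Uu; apply/IHk/Usum.
by exists u => //; exists 0; [exact: nbhs_singleton (U0 _)|rewrite addr0].
Qed.

(** The knots play the role of balls of radius 2 ^ (- n): a finite sum of
    elements of successive knots stays in the knot before the first one. *)
Lemma string_sum_nat (x : nat -> G) : (forall i, U i.+2 (x i)) ->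
  forall k m, U k.+1 (\sum_(k <= i < k + m) x i).
Proof.
move=> Ux k m; elim: m k => [|m IHm] k.
  by rewrite addn0 big_geq //; exact: nbhs_singleton (U0 _).
rewrite big_ltn ?addnS ?ltnS ?leq_addr // -addSn.
by apply: Usum; exists (x k) => //; exists (\sum_(k.+1 <= i < k.+1 + m) x i).
Qed.

Lemma string_cauchy_cvg (s : nat -> G) : gcomplete G ->
  (forall W : set G, nbhs 0 W -> exists n, U n.+1 `<=` W) ->
  (forall k m, U k.+1 (s (k + m)%N - s k)) ->
  exists x : G, s @ \oo --> x.
Proof.
move=> Gcomplete Ubase Us; apply: Gcomplete => W /Ubase[n UW].
exists (s @` [set i | (n.+1 <= i)%N]).
  by exists n.+1 => // i ni; exists i.
move=> _ _ [i /= /subnKC <- <-] [j /= /subnKC <- <-]; apply/UW/Usum.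
set a := s n.+1; exists (s (n.+1 + (i - n.+1))%N - a); first exact: Us.
exists (- (s (n.+1 + (j - n.+1))%N - a)); last by rewrite opprB addrA subrK.
apply: balancedN (Us _ _).
by case: Utop => -[/(_ n.+2 isT)[]].
Qed.

(** Successive approximation: the knots of U shrink to 0 and all the closures of
    their images are neighbourhoods of 0, so the error left by each approximation
    can be approximated again from the next knot. *)
Lemma closure_image_sub_image_closure (T : {linear G -> F}) :
  gcomplete G -> hausdorff_space F -> continuous T ->
  (forall W : set G, nbhs 0 W -> exists n, U n.+1 `<=` W) ->
  (forall n, (0 < n)%N -> nbhs 0 (closure (T @` U n))) ->
  closure (T @` U 2%N) `<=` T @` closure (U 1%N).
Proof.
move=> Gcomplete Fhaus Tcont Ubase cl0 y cly.
have /choice[f fP] : forall p : nat * F, exists x, closure (T @` U p.1.+2) p.2 ->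
    U p.1.+2 x /\ closure (T @` U p.1.+3) (p.2 - T x).
  move=> [k z] /=; have [clz|nclz] := pselect (closure (T @` U k.+2) z).
    have [_ [[x Ux <-] clx]] := clz _ (nbhs_subl z (cl0 k.+3 isT)).
    by exists x.
  by exists 0.
(* r k is the error left after k corrections, x k the next correction and s k
   the sum of the first k corrections. *)
pose r := fix r k := if k is k'.+1 then r k' - T (f (k', r k')) else y.
pose x k := f (k, r k).
have clr k : closure (T @` U k.+2) (r k).
  by elim: k => [//|k IHk]; have [] := fP (k, r k) IHk.
have Ux k : U k.+2 (x k) by have [] := fP (k, r k) (clr k).
pose s k := \sum_(0 <= i < k) x i.
have sB k m : U k.+1 (s (k + m)%N - s k).
  rewrite /s (big_cat_nat (n := k)) ?leq_addr //= addrAC subrr add0r.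
  exact: string_sum_nat.
have rE k : r k = y - T (s k).
  elim: k => [|k IHk]; first by rewrite /s big_geq // linear0 subr0.
  by rewrite /s big_nat_recr //= -/(s k) linearD opprD addrA -IHk.
have [l sl] := string_cauchy_cvg Gcomplete Ubase sB.
exists l.
  move=> B /sl[n _ nB]; exists (s n); split; last exact: (nB n (leqnn n)).
  by have := sB 0%N n; rewrite add0n /s [in X in _ - X]big_geq // subr0.
(* r k is in the closure of T (U k.+2), and V + V contains the closure of every
   subset of V. *)
have r0 : r @ \oo --> (0 : F).
  move=> W W0; have [V V0 VW] := nbhs0_sum W0.
  have [n UV] : exists n, U n.+1 `<=` T @^-1` V.
    by apply: Ubase; apply: Tcont; rewrite linear0.
  exists n => // k /= nk; apply: VW.
  apply: closure_sub_sum V0 _ _; apply: closureS (clr k).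
  move=> _ [u Uu <-]; apply: UV; apply: string_decreasing Uu.
  exact: leq_trans nk (leqnSn k).
have rl : r @ \oo --> y - T l.
  rewrite (funext rE); apply: tmod_cvgB; first exact: cvg_cst.
  exact: continuous_cvg (Tcont l) sl.
by apply/esym/subr0_eq; apply: cvg_unique Fhaus _ _ _ _ rl r0.
Qed.

End CompletenessAndStrings.

Lemma metrizable_countable_base (R : realType) (M : topologicalModType (gcomplex R)) :
  metrizable M -> exists B : nat -> set M, (forall n, nbhs 0 (B n)) /\
    forall W : set M, nbhs 0 W -> exists n, B n `<=` W.
Proof.
move=> [d [_ _ _ dE]]; exists (fun n => [set y | d 0 y < n.+1%:R^-1]); split.
  by move=> n; rewrite dE; exists n.+1%:R^-1; rewrite //= invr_gt0.
move=> W; rewrite dE => -[e /= e0 eW]; exists (Num.bound e^-1) => y /= dy.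
apply: eW => /=; apply: lt_le_trans dy _.
rewrite invf_ple ?posrE // ltW // (lt_trans (archi_boundP _)) ?ltr_nat //.
by rewrite invr_ge0 ltW.
Qed.

Lemma image_nbhs0_open (R : realType) (G F : topologicalModType (gcomplex R))
    (T : {linear G -> F}) :
  (forall W : set G, nbhs 0 W -> nbhs 0 (T @` W)) -> open_map T.
Proof.
move=> T0 A Aopen; rewrite openE => _ [a Aa <-].
have /T0/(nbhs_subr (T a)) := nbhs_addl (open_nbhs_nbhs (conj Aopen Aa)).
apply: filterS => y /= [u Au Tu]; exists (a + u) => //.
by rewrite linearD Tu subrKC.
Qed.

Theorem theorem3p26 (R : realType) (G F : topologicalModType (gcomplex R))
    (T : {linear G -> F}) :
  frechet G -> hausdorff_space F -> barrelled F ->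
  set_surj setT setT T -> continuous T -> open_map T.
Proof.
move=> [Gcomplete Gmetr _] Fhaus Fbarrelled Tsurj Tcont.
apply: image_nbhs0_open => W W0.
have [B [B0 Bbase]] := metrizable_countable_base Gmetr.
have [U [Utop UW UB]] := topological_string_exists B0 W0.
have Ubase (V : set G) : nbhs 0 V -> exists n, U n.+1 `<=` V.
  by move=> /Bbase[n BV]; exists n; exact: subset_trans BV.
have [_ cl0] := Fbarrelled _ (closed_string_closure_image Tsurj (proj1 Utop)).
apply: filterS (cl0 2%N isT); apply: subset_trans.
  exact: closure_image_sub_image_closure.
apply: image_subset; apply: subset_trans UW.
by apply: closure_sub_sum; case: Utop => _; apply.
Qed.
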